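(* Let $\mathfrak t$ be a semibounded sesquilinear form in a complex Hilbert space $\mathfrak H$. Then its regular part $\mathfrak t_{\rm reg}$ satisfies $\mathfrak t_{\rm reg}\le\mathfrak t$. Let $\mathfrak u$ be a semibounded form in $\mathfrak H$ and assume that $\mathfrak u\le\mathfrak t$; then $$\mathfrak u_{\rm reg}\le\mathfrak t_{\rm reg}.$$ In particular, if the semibounded form $\mathfrak u$ is closable and $\mathfrak u\le\mathfrak t$, then $\mathfrak u\le\mathfrak t_{\rm reg}$. Consequently, $\mathfrak t_{\rm reg}$ is the largest of all closable semibounded forms below $\mathfrak t$ (i.e. $\mathfrak t_{\rm reg}$ is itself a closable semibounded form with $\mathfrak t_{\rm reg}\le\mathfrak t$, and every closable semibounded form $\mathfrak u\le\mathfrak t$ satisfies $\mathfrak u\le\mathfrak t_{\rm reg}$).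
   Context: A (sesquilinear) form $\mathfrak t$ in $\mathfrak H$ is a map $\operatorname{dom}\mathfrak t\times\operatorname{dom}\mathfrak t\to\mathbb C$, linear in the first and antilinear in the second entry, where $\operatorname{dom}\mathfrak t$ is a (not necessarily dense) linear subspace of $\mathfrak H$; $\mathfrak t[\varphi]=\mathfrak t[\varphi,\varphi]$. It is semibounded if there is $c\in\mathbb R$ with $\mathfrak t[\varphi]\ge c\|\varphi\|^2$ on $\operatorname{dom}\mathfrak t$; the greatest such $c$ is the lower bound $m(\mathfrak t)\in\mathbb R$ (so $\operatorname{dom}\mathfrak t\neq\{0\}$ is understood). The inequality $\mathfrak t_1\le\mathfrak t_2$ means $\operatorname{dom}\mathfrak t_2\subset\operatorname{dom}\mathfrak t_1$ and $\mathfrak t_1[\varphi]\le\mathfrak t_2[\varphi]$ for all $\varphi\in\operatorname{dom}\mathfrak t_2$. A semibounded form $\mathfrak t$ is closable if for every sequence $\varphi_n\in\operatorname{dom}\mathfrak t$ with $\varphi_n\to0$ in $\mathfrak H$ and $\mathfrak t[\varphi_n-\varphi_m]\to0$ one has $\mathfrak t[\varphi_n]\to0$. Regular part: choose $c\le m(\mathfrak t)$ and a linear operator $Q$ from $\mathfrak H$ to a Hilbert space $\mathfrak K$ (a representing map for $\mathfrak t-c$; one always exists) with $\operatorname{dom}Q=\operatorname{dom}\mathfrak t$ and $\mathfrak t[\varphi,\psi]=c(\varphi,\psi)+(Q\varphi,Q\psi)$ for $\varphi,\psi\in\operatorname{dom}\mathfrak t$. Let $Q^{**}\subset\mathfrak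 H\times\mathfrak K$ be the closure of the graph of $Q$, $\operatorname{mul}Q^{**}=\{\omega:\{0,\omega\}\in Q^{**}\}$, $P_0$ the orthogonal projection of $\mathfrak K$ onto $\operatorname{mul}Q^{**}$, and $Q_{\rm reg}=(I-P_0)Q$. Then $$\mathfrak t_{\rm reg}[\varphi,\psi]=c(\varphi,\psi)+(Q_{\rm reg}\varphi,Q_{\rm reg}\psi),\qquad\varphi,\psi\in\operatorname{dom}\mathfrak t_{\rm reg}=\operatorname{dom}\mathfrak t .$$ The statements hold for any such choice of $c$ and $Q$; $\mathfrak u_{\rm reg}$ is defined in the same way from $\mathfrak u$. *)

(* Defs.v *)
From HB Require Import structures.
From mathcomp Require Import all_boot all_order all_algebra sesquilinear.
From mathcomp Require Import complex.
From mathcomp Require Import all_classical all_reals all_analysis.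

Set Implicit Arguments.
Unset Strict Implicit.
Unset Printing Implicit Defensive.

Import Order.TTheory GRing.Theory Num.Theory.
Import numFieldNormedType.Exports.

Local Open Scope classical_set_scope.
Local Open Scope ring_scope.
Local Open Scope complex_scope.

(* [{dot H for _}] is linear in the first argument and conjugate-linear in the
   second one. *)
HB.mixin Record CompleteNormedModule_isHilbert (R : realType) H
    of CompleteNormedModule R[i] H := {
  inner : {dot H for (@Num.conj R[i])};
  inner_norm : forall x : H, inner x x = `|x| ^+ 2
}.

#[short(type="hilbertType")]
HB.structure Definition Hilbert (R : realType) :=
  {H of CompleteNormedModule_isHilbert R H & CompleteNormedModule R[i] H}.

Section Operators.
Context {R : realType} {H K : hilbertType R}.

(* A function defined on a subset of [H]; its values outside of [op_dom] are
   irrelevant. *)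
Record operator := Operator { op_dom : set H; op_val :> H -> K }.

Definition linear_operator (Q : operator) :=
  submod_closed [in op_dom Q] /\
  (forall (a : R[i]) (x y : H), op_dom Q x -> op_dom Q y ->
     Q (a *: x + y) = a *: Q x + Q y).

Definition graph (Q : operator) : set (H * K) :=
  [set p | op_dom Q p.1 /\ p.2 = Q p.1].

Definition mul_part (A : set (H * K)) : set K := [set w | A (0, w)].

End Operators.
Arguments operator {R} H K.

(* The orthogonal projection of [x] onto [M]; when [M] is a closed subspace
   there is exactly one [p] as below, otherwise the value may be the default
   [0]. *)
Definition orthproj {R : realType} {K : hilbertType R} (M : set K) (x : K) : K :=
  xget 0 [set p | M p /\ forall m, M m -> inner (x - p) m = 0].

Definition reg_op {R : realType} {H K : hilbertType R} (Q : operator H K) :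
    operator H K :=
  Operator (op_dom Q)
    (fun x => Q x - orthproj (mul_part (closure (graph Q))) (Q x)).

Section Forms.
Context {R : realType} {H : hilbertType R}.

(* A function of two variables in [pf_dom]; its values elsewhere are
   irrelevant. *)
Record pform := PForm { pf_dom : set H; pf_val :> H -> H -> R[i] }.

Implicit Types t u : pform.

Definition sesquilinear_form t :=
  [/\ submod_closed [in pf_dom t],
      (forall (a : R[i]) (x y z : H),
         pf_dom t x -> pf_dom t y -> pf_dom t z ->
         t (a *: x + y) z = a * t x z + t y z) &
      (forall (a : R[i]) (x y z : H),
         pf_dom t x -> pf_dom t y -> pf_dom t z ->
         t z (a *: x + y) = Num.conj a * t z x + t z y)].

(* In the order of [R[i]], [z <= w] means that [w - z] is a nonnegative real;
   hence [t x x] is required to be real. *)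
Definition bounded_below t (c : R) :=
  forall x, pf_dom t x -> c%:C * `|x| ^+ 2 <= t x x.

Definition semibounded_form t :=
  [/\ sesquilinear_form t,
      exists2 x, pf_dom t x & x != 0 &
      exists c, bounded_below t c].

Definition lower_bound t : R := sup [set c | bounded_below t c].

Definition le_form t1 t2 :=
  pf_dom t2 `<=` pf_dom t1 /\ forall x, pf_dom t2 x -> t1 x x <= t2 x x.

Definition closable t :=
  forall x : nat -> H, (forall n, pf_dom t (x n)) ->
    x n @[n --> \oo] --> (0 : H) ->
    t (x p.1 - x p.2) (x p.1 - x p.2) @[p --> (\oo, \oo)] --> (0 : R[i]^o) ->
    t (x n) (x n) @[n --> \oo] --> (0 : R[i]^o).

Definition representing_map {K : hilbertType R} t (c : R) (Q : operator H K) :=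
  [/\ linear_operator Q,
      op_dom Q = pf_dom t &
      forall x y, pf_dom t x -> pf_dom t y ->
        t x y = c%:C * inner x y + inner (Q x) (Q y)].

Definition reg_form {K : hilbertType R} t (c : R) (Q : operator H K) : pform :=
  PForm (pf_dom t)
    (fun x y => c%:C * inner x y + inner (reg_op Q x) (reg_op Q y)).

End Forms.
Arguments pform {R} H.

(* Main.v *)
(* Two facts about reg_op Q.  First, (x, reg_op Q x) lies in the closure of the
   graph of Q, so there are x_n -> x in the domain with Q x_n -> reg_op Q x;
   hence t[x_n] tends to t_reg[x] while t[x_n - x_m] -> 0.  Second, its values
   are orthogonal to the multivalued part, which makes t_reg closable.

   If u <= t is closable, then u[x_n - x_m] -> 0, so closability applied to
   x_n - x gives u[x_n - x] -> 0, hence u[x] = lim u[x_n] <= lim t[x_n]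
   = t_reg[x].  No representing map of u is involved.  The comparison of u_reg
   with t_reg for a general u <= t is this statement for the closable form
   u_reg <= u <= t. *)
Require Import Defs.
From mathcomp Require Import all_boot all_order all_algebra complex.
From mathcomp Require Import all_classical all_reals all_analysis.
From mathcomp Require Import sesquilinear ring lra.

Set Implicit Arguments.
Unset Strict Implicit.
Unset Printing Implicit Defensive.

Import Order.TTheory GRing.Theory Num.Theory.
Import numFieldNormedType.Exports.

Local Open Scope classical_set_scope.
Local Open Scope ring_scope.
Local Open Scope complex_scope.

(** Removes the factor left by a weighted Young inequality: for [b > 0] the weight [e / b] turns the
    bound into [b + e], and for [b = 0] any single weight suffices. *)
Lemma ler_mul1D_gt0 (K : numFieldType) (a b : K) : 0 <= b ->
  (forall e, 0 < e -> a <= (1 + e) * b) -> a <= b.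
Proof.
rewrite le_eqVlt => /predU1P[<- /(_ 1 ltr01)|b0 ab]; first by rewrite mulr0.
apply/ler_addgt0Pr => e e0; have := ab (e / b) (divr_gt0 e0 b0).
by rewrite mulrDl mul1r divfK// gt_eqF.
Qed.

(** * Limits and inequalities in a partially ordered numeric field *)

Section NumFieldLimits.
Context {K : numFieldType} {T : Type} {F : set_system T} {FF : ProperFilter F}.

(* The positive cone is closed although the order of [K] need not be total:
   [0 <= f] means [`|f| = f], and limits are unique. *)
Lemma cvg_ge0 (f : T -> K) (a : K) :
  f @ F --> a -> (forall x, 0 <= f x) -> 0 <= a.
Proof.
move=> fa f0; suff -> : a = `|a| by [].
apply: (cvg_unique _ fa) => //.
have -> : f = (fun x => `|f x|) by apply/funext => x; rewrite ger0_norm.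
exact: (@cvg_norm _ K^o).
Qed.

Lemma cvg_le (f g : T -> K) (a b : K) :
  f @ F --> a -> g @ F --> b -> (forall x, f x <= g x) -> a <= b.
Proof.
move=> fa gb fg; rewrite -subr_ge0; apply: (@cvg_ge0 (g - f)).
  exact: (@cvgB _ K^o).
by move=> x; rewrite /= subr_ge0.
Qed.

Lemma squeeze_cvg0 (f g : T -> K) :
  g @ F --> (0 : K) -> (forall x, 0 <= f x <= g x) -> f @ F --> (0 : K).
Proof.
move=> /(@cvgr0Pnorm_lt _ K^o) g0 fg; apply/(@cvgr0Pnorm_lt _ K^o) => e /g0.
apply: filterS => x; have /andP[f0 fgx] := fg x.
by rewrite !ger0_norm//; [exact: le_lt_trans|exact: le_trans fgx].
Qed.

Lemma cvgMlD (k : K) (f g : T -> K) (a b : K) :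
  f @ F --> a -> g @ F --> b -> k * f x + g x @[x --> F] --> k * a + b.
Proof. by move=> fa gb; apply: (@cvgD _ K^o) => //; exact: cvgMl_tmp. Qed.

Lemma cvgMlD0 (k : K) (f g : T -> K) :
  f @ F --> (0 : K) -> g @ F --> (0 : K) ->
  k * f x + g x @[x --> F] --> (0 : K).
Proof. by move=> f0 /(cvgMlD (k := k) f0); rewrite mulr0 addr0. Qed.

Lemma eq_cvgl (f g : T -> K) (a : K) : f =1 g -> f @ F --> a -> g @ F --> a.
Proof. by move=> /funext ->. Qed.

Lemma sqr_norm_cvg0 (V : normedModType K) (f : T -> V) :
  `|f x| ^+ 2 @[x --> F] --> (0 : K) -> f @ F --> (0 : V).
Proof.
move=> /(@cvgr0Pnorm_lt _ K^o) f0; apply/cvgr0Pnorm_lt => e e0.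
have /f0 : 0 < e ^+ 2 by rewrite exprn_gt0.
apply: filterS => x; rewrite ger0_norm ?exprn_ge0//.
by rewrite ltr_pXn2r// nnegrE// ltW.
Qed.

Lemma cvg_sqr_norm (V : normedModType K) (f : T -> V) (a : V) :
  f @ F --> a -> `|f x| ^+ 2 @[x --> F] --> (`|a| ^+ 2 : K).
Proof.
move=> fa; rewrite expr2.
rewrite [X in X @ F --> _](_ : _ = (fun x => `|f x| * `|f x|)) //.
by apply: cvgM; apply: cvg_norm.
Qed.

Lemma cvg_sqr_norm0 (V : normedModType K) (f : T -> V) :
  f @ F --> (0 : V) -> `|f x| ^+ 2 @[x --> F] --> (0 : K).
Proof. by move=> /cvg_sqr_norm; rewrite normr0 expr0n. Qed.

(** Turns the Cauchy property of a filter into a double limit, the form in which closability of a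
    form is stated. *)
Lemma cauchy_subP (V : normedModType K) (f : T -> V) :
  cauchy (f @ F) <-> f p.1 - f p.2 @[p --> (F, F)] --> (0 : V).
Proof.
rewrite -cauchy_ballP; split=> [fF|/cvgr0Pnorm_lt fF e /fF].
  apply/cvgr0Pnorm_lt => e /fF; rewrite !near_simpl near_map2.
  by apply: filterS => -[x y]; rewrite -ball_normE.
rewrite !near_simpl near_map2.
by apply: filterS => -[x y]; rewrite -ball_normE.
Qed.

End NumFieldLimits.

(** * Sequences over the complex scalars and sequential closure *)

Section ComplexSequences.
Context {R : realType}.

Lemma cvg_harmonic_complex : (n.+1%:R^-1 : R[i]) @[n --> \oo] --> (0 : R[i]^o).
Proof.
apply/(@cvgr0Pnorm_lt _ R[i]^o) => e e0.
(* A positive element of [R[i]] is real, so the estimate can be made in [R]. *)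
have eE : (complex.Re e)%:C = e by rewrite RRe_real// gtr0_real.
have re0 : 0 < complex.Re e by rewrite -ltcR eE.
near=> n; rewrite ger0_norm ?invr_ge0 ?ler0n// -eE.
rewrite (_ : n.+1%:R^-1 = (n.+1%:R^-1)%:C); last first.
  by rewrite fmorphV rmorph_nat.
rewrite ltcR; near: n; exact: (near_infty_natSinv_lt (PosNum re0)).
Unshelve. all: by end_near. Qed.

Lemma closure_seqP (V : normedModType R[i]) (A : set V) (p : V) :
  closure A p <->
  exists2 x : nat -> V, (forall n, A (x n)) & x n @[n --> \oo] --> p.
Proof.
split=> [Ap|[x Ax xp]]; last first.
  apply: (closed_cvg (closure A)) xp => //; first exact: closed_closure.
  by apply: nearW => n; apply: subset_closure.
have [x xP] := choice (fun n => Ap _ (nbhsx_ballx p (n.+1%:R^-1 : R[i])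
  ltac:(by rewrite invr_gt0 ltr0n))).
exists x => [n|]; first by case: (xP n).
apply/cvgrPdist_lt => e e0.
move/(@cvgr0Pnorm_lt _ R[i]^o): cvg_harmonic_complex => /(_ _ e0); apply: filterS => n; rewrite ger0_norm ?invr_ge0 ?ler0n//.
by apply: lt_trans; have [_] := xP n; rewrite -ball_normE.
Qed.

End ComplexSequences.

(** * Linear subspaces and their closures *)

Section ClosedSubspaces.
Context {R : realType}.

Lemma submod_closedP (V : lmodType R[i]) (A : set V) :
  submod_closed [in A] <->
  A 0 /\ forall (a : R[i]) x y, A x -> A y -> A (a *: x + y).
Proof.
split=> -[A0 AP]; split; first by rewrite inE in A0.
- move=> a x y Ax Ay; have := AP a x y.
  by rewrite !inE; apply.
- by rewrite inE.
- by move=> a x y; rewrite !inE; exact: AP.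
Qed.

Lemma submod_closedB (V : lmodType R[i]) (A : set V) (x y : V) :
  submod_closed [in A] -> A x -> A y -> A (x - y).
Proof.
by move=> /submod_closedP[_ AP] Ax Ay; rewrite addrC -scaleN1r; exact: AP.
Qed.

Lemma submod_closed_closure (V : normedModType R[i]) (A : set V) :
  submod_closed [in A] -> submod_closed [in closure A].
Proof.
move=> /submod_closedP[A0 AP]; apply/submod_closedP; split.
  exact: subset_closure.
move=> a x y /closure_seqP[u Au ux] /closure_seqP[v Av vy].
apply/closure_seqP; exists (fun n => a *: u n + v n).
  by move=> n; apply: AP.
by apply: cvgD => //; apply: cvgZl_tmp.
Qed.

End ClosedSubspaces.

(** * Existence of the orthogonal projection onto a closed subspace *)

Section Projection.
Context {R : realType} {H : hilbertType R}.
Implicit Types (x y : H) (M : set H).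

(** Norms take values in [R[i]]; the infimum defining the distance to a subspace needs values in
    [R]. *)
Let N x : R := complex.Re (`|x| ^+ 2).

Let NE x : `|x| ^+ 2 = (N x)%:C.
Proof. by rewrite RRe_real// realX// normr_real. Qed.

Lemma parallelogram x y :
  `|x - y| ^+ 2 = 2 * `|x| ^+ 2 + 2 * `|y| ^+ 2 - `|x + y| ^+ 2.
Proof. by rewrite -!inner_norm dnormB dnormD; ring. Qed.

Lemma minimizer_orthogonal x y :
  (forall a : R[i], `|x| ^+ 2 <= `|x - a *: y| ^+ 2) -> inner x y = 0.
Proof.
move=> xmin; have [->|y0] := eqVneq y 0; first by rewrite linear0r.
have n0 : 0 < `|y| ^+ 2 by rewrite exprn_gt0// normr_gt0.
(* With this coefficient [a *: y] is the component of [x] along [y], and removing it lowers the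
   squared norm by [|inner x y| ^+ 2 / |y| ^+ 2]. Minimality forces that loss to vanish. *)
have := xmin (inner x y / `|y| ^+ 2).
rewrite -!inner_norm dnormB dnormZ linearZr_LR /= !inner_norm.
rewrite rmorphM fmorphV /= (conj_Creal (gtr0_real n0)).
set s := inner x y; set n := `|y| ^+ 2.
have -> : s^* / n * s = `|s| ^+ 2 / n by rewrite normCK mulrAC [s^* * s]mulrC.
rewrite [X in _ - (_ + X)]conj_Creal; last first.
  by rewrite realM ?realX ?normr_real// realV gtr0_real.
rewrite normrM normfV (gtr0_norm n0) -/n exprMn.
have -> : `|s| ^+ 2 * n^-1 ^+ 2 * n = `|s| ^+ 2 / n.
  by rewrite expr2 -!mulrA mulVf ?mulr1// gt_eqF.
have addKB (a b : R[i]) : a + b - (b + b) = a - b by ring.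
rewrite addKB.
rewrite lerDl oppr_ge0 pmulr_lle0 ?invr_gt0// => sle0.
by apply/eqP; rewrite -normr_eq0 -sqrf_eq0 eq_le sle0 exprn_ge0.
Qed.

(** A sequence in [M] minimizing the distance to [x] is Cauchy by the parallelogram law. Its limit
    attains the distance, and a minimal residual is orthogonal to [M]. *)
Lemma orthproj_exists M x : submod_closed [in M] -> closed M ->
  exists p, M p /\ forall m, M m -> inner (x - p) m = 0.
Proof.
move=> /[dup] /submod_closedP[M0 ML] Msub Mcl.
pose S := [set N (x - m) | m in M]; pose d := inf S.
have N_ge0 z : 0 <= N z by rewrite -lecR -NE exprn_ge0.
have Slb : has_lbound S by exists 0 => _ [m _ <-].
have dP m : M m -> d <= N (x - m) by move=> Mm; apply: ge_inf => //; exists m.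
have /choice[u uP] n : exists m, M m /\ N (x - m) < d + n.+1%:R^-1.
  have n0 : 0 < n.+1%:R^-1 :> R by rewrite invr_gt0 ltr0n.
  have S0 : S !=set0 by exists (N (x - 0)), 0.
  by have [_ [m Mm <-] mlt] := inf_adherent n0 (conj S0 Slb); exists m.
(* The midpoint of [m] and [m'] lies in [M], so its squared distance to [x] is at least [d]; the
   parallelogram law then bounds [m - m']. *)
have half m m' : M m -> M m' ->
    N (m - m') <= 2 * N (x - m) + 2 * N (x - m') - 4 * d.
  move=> Mm Mm'; pose z := (2^-1 : R[i]) *: (m + m').
  have Mz : M z.
    by rewrite /z -[_ *: _]addr0; apply: (ML) => //;
      rewrite -[m]scale1r; apply: ML.
  have E : N (m - m') = 2 * N (x - m) + 2 * N (x - m') - 4 * N (x - z).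
    apply: (@complexI R).
    rewrite !(rmorphB, rmorphD, rmorphM, rmorph_nat) /= -!NE.
    rewrite distrC (_ : m' - m = (x - m) - (x - m')); last first.
      by rewrite opprB [RHS]addrC addrA subrK.
    rewrite parallelogram; congr (_ - _).
    rewrite (_ : x - m + (x - m') = (2 : R[i]) *: (x - z)); last first.
      rewrite scalerBr scalerA divff ?pnatr_eq0// scale1r scaler_nat mulr2n.
      by rewrite opprD addrACA.
    by rewrite normrZ exprMn ger0_norm// -natrX.
  by rewrite E; have := dP _ Mz; lra.
have : cauchy (u @ \oo).
  apply/cauchy_subP/sqr_norm_cvg0.
  (* In [half] the excesses of [u i] and [u j] over [d] are below [1/(i+1)] and [1/(j+1)], and the
     multiples of [d] cancel. *)
  apply: (@squeeze_cvg0 _ _ _ _ _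
    (fun p => 2 * (p.1.+1%:R^-1 : R[i]) + 2 * (p.2.+1%:R^-1 : R[i]))).
    rewrite -[X in _ --> X](addr0 (0 : R[i]^o)).
    apply: (@cvgD _ R[i]^o); rewrite -[X in _ --> X](mulr0 (2 : R[i]^o)).
      apply: (@cvgMl_tmp _ _ _ _ (fun p : nat * nat => p.1.+1%:R^-1 : R[i])).
      exact: (cvg_comp _ _ cvg_fst (cvg_harmonic_complex)).
    apply: (@cvgMl_tmp _ _ _ _ (fun p : nat * nat => p.2.+1%:R^-1 : R[i])).
    exact: (cvg_comp _ _ cvg_snd (cvg_harmonic_complex)).
  move=> [i j] /=; rewrite exprn_ge0//= NE.
  have -> : 2 * (i.+1%:R^-1 : R[i]) + 2 * j.+1%:R^-1
      = (2 * i.+1%:R^-1 + 2 * j.+1%:R^-1)%:C.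
    by rewrite rmorphD !rmorphM !fmorphV !rmorph_nat.
  rewrite lecR; have [Mi ui] := uP i; have [Mj uj] := uP j.
  move: (i.+1%:R^-1) (j.+1%:R^-1) ui uj (half _ _ Mi Mj) => a b ui uj.
  by move=> h; lra.
move=> /cauchy_cvgP/cvg_ex[p up].
have Mp : M p.
  by apply: (closed_cvg M) up => //; apply: nearW => n; case: (uP n).
exists p; split=> // m Mm; apply: minimizer_orthogonal => a.
(* The limit along [u] gives [|x - p| ^+ 2 <= d], and [d] bounds the right side from below since
   [p + a *: m] lies in [M]. *)
apply: (@le_trans _ _ d%:C).
  apply: (@cvg_le _ _ \oo _ (fun n => `|x - u n| ^+ 2)
      (fun n => d%:C + n.+1%:R^-1)).
  - by apply: cvg_sqr_norm; apply: cvgB => //; apply: cvg_cst.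
  - rewrite -[X in _ --> X](addr0 (d%:C : R[i]^o)).
    by apply: (@cvgD _ R[i]^o); [apply: cvg_cst|exact: cvg_harmonic_complex].
  - move=> n; rewrite NE -(rmorph_nat (real_complex R)) -fmorphV -rmorphD lecR.
    by case: (uP n) => _ /ltW.
rewrite NE lecR -addrA -opprD; apply: dP.
by rewrite addrC; apply: ML.
Qed.

(** Existence ensures that [xget] never falls back on its default value. *)
Lemma orthprojP M x : submod_closed [in M] -> closed M ->
  M (orthproj M x) /\ forall m, M m -> inner (x - orthproj M x) m = 0.
Proof.
move=> Msub Mcl; rewrite /orthproj; have [p pP] := orthproj_exists x Msub Mcl.
by case: xgetP => [q _ /= []|/(_ p)].
Qed.

End Projection.

(** * Inner product identities *)

Section InnerProduct.
Context {R : realType} {H : hilbertType R}.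
Implicit Types x y z : H.

Lemma innerPl (a : R[i]) x y z :
  inner (a *: x + y) z = a * inner x z + inner y z.
Proof. exact: linearPl. Qed.

Lemma innerPr (a : R[i]) x y z :
  inner z (a *: x + y) = Num.conj a * inner z x + inner z y.
Proof. exact: linearPr. Qed.

Lemma innerBl x y z : inner (x - y) z = inner x z - inner y z.
Proof. exact: linearBl. Qed.

Lemma pythagoras x y :
  inner x y = 0 -> `|x + y| ^+ 2 = `|x| ^+ 2 + `|y| ^+ 2.
Proof. by move=> xy; rewrite -!inner_norm; exact: hnormDd. Qed.

Lemma pythagorasB x y :
  inner x y = 0 -> `|x - y| ^+ 2 = `|x| ^+ 2 + `|y| ^+ 2.
Proof. by move=> xy; rewrite -!inner_norm; exact: hnormBd. Qed.

End InnerProduct.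

(** * Uniqueness, linearity and contractivity of the projection *)

Section OrthogonalProjection.
Context {R : realType} {H : hilbertType R} (M : set H).
Hypotheses (Msub : submod_closed [in M]) (Mcl : closed M).

(** The difference of two candidates lies in [M] and is orthogonal to [M], hence to itself. *)
Lemma orthproj_uniq (x p : H) :
  M p -> (forall m, M m -> inner (x - p) m = 0) -> orthproj M x = p.
Proof.
move=> Mp px; have [Mq qx] := orthprojP x Msub Mcl.
set q := orthproj M x in Mq qx *; apply/eqP.
rewrite -subr_eq0 -(dnorm_eq0 inner).
have Mqp := submod_closedB Msub Mq Mp.
have := innerBl (x - p) (x - q) (q - p).
rewrite px// qx// subr0 opprB [X in inner X _](_ : _ = q - p) => [->//|].
by rewrite addrC addrA subrK.
Qed.

Lemma orthprojL (a : R[i]) (x y : H) :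
  orthproj M (a *: x + y) = a *: orthproj M x + orthproj M y.
Proof.
have [Mx xP] := orthprojP x Msub Mcl; have [My yP] := orthprojP y Msub Mcl.
apply: orthproj_uniq => [|m Mm]; first by case/submod_closedP: Msub => _; apply.
rewrite (_ : _ - _ = a *: (x - orthproj M x) + (y - orthproj M y)).
  by rewrite innerPl xP// yP// mulr0 addr0.
by rewrite scalerBr opprD addrACA.
Qed.

Lemma normB_orthproj_le (x : H) : `|x - orthproj M x| ^+ 2 <= `|x| ^+ 2.
Proof.
have [Mx xP] := orthprojP x Msub Mcl; set p := orthproj M x in Mx xP *.
have := pythagoras (xP _ Mx); rewrite subrK => ->.
by rewrite lerDl exprn_ge0.
Qed.

End OrthogonalProjection.

(** * The regular part of a linear operator *)

Section RegularPart.
Context {R : realType} {H K : hilbertType R} (Q : operator H K).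
Hypothesis Qlin : linear_operator Q.

Let M := mul_part (closure (graph Q)).

Lemma submod_closed_graph : submod_closed [in graph Q].
Proof.
case: Qlin => /submod_closedP[D0 DL] QL; apply/submod_closedP; split.
  split=> //=; have := QL 1 0 0 D0 D0; rewrite !scale1r addr0 => /eqP.
  by rewrite -subr_eq0 opprD addrA subrr add0r oppr_eq0 => /eqP.
move=> a [x1 y1] [x2 y2] [/= D1 ->] [/= D2 ->].
by split=> /=; [exact: DL|rewrite QL].
Qed.

Let Msub : submod_closed [in M].
Proof.
have /submod_closedP[G0 GL] := submod_closed_closure submod_closed_graph.
apply/submod_closedP; split=> // a x y Mx My; have := GL a _ _ Mx My.
rewrite /M /mul_part /=; congr (closure _ _).
by congr pair; rewrite /= scaler0 addr0.
Qed.

Let Mcl : closed M.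
Proof.
apply: closed_comp; last exact: closed_closure.
by move=> w _; apply: cvg_pair; [exact: cvg_cst|exact: cvg_id].
Qed.

Lemma reg_op_linear (a : R[i]) (x y : H) : op_dom Q x -> op_dom Q y ->
  reg_op Q (a *: x + y) = a *: reg_op Q x + reg_op Q y.
Proof.
case: Qlin => _ QL Dx Dy.
by rewrite /= QL// orthprojL// scalerBr opprD addrACA.
Qed.

Lemma reg_op_norm_le x : `|reg_op Q x| ^+ 2 <= `|Q x| ^+ 2.
Proof. exact: normB_orthproj_le. Qed.

Lemma reg_op_orth x w : closure (graph Q) (0, w) -> inner (reg_op Q x) w = 0.
Proof. by move=> Mw; have [_] := orthprojP (Q x) Msub Mcl; apply. Qed.

(** The closure of the graph is a subspace containing both [(x, Q x)] and [(0, orthproj M (Q x))];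
    the pair is their difference. *)
Lemma reg_op_closure x : op_dom Q x -> closure (graph Q) (x, reg_op Q x).
Proof.
move=> Dx; have [Mp _] := orthprojP (Q x) Msub Mcl.
have := submod_closedB (submod_closed_closure submod_closed_graph) _ Mp.
move=> /(_ (x, Q x)); rewrite /reg_op /=.
rewrite (_ : (x, _) - _ = (x, Q x - orthproj M (Q x))); last first.
  by congr pair; rewrite /= subr0.
by apply; apply: subset_closure.
Qed.

Lemma reg_op_approx x : op_dom Q x -> exists u : nat -> H,
  [/\ forall n, op_dom Q (u n), u n @[n --> \oo] --> x &
      Q (u n) @[n --> \oo] --> (reg_op Q x : K)].
Proof.
move=> /reg_op_closure/closure_seqP[v vQ vx].
exists (fun n => (v n).1); split=> [n||].
- by case: (vQ n).
- exact: (cvg_comp _ _ vx cvg_fst).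
- rewrite (_ : (fun n => _) = (fun n => (v n).2)).
    exact: (cvg_comp _ _ vx cvg_snd).
  by apply/funext => n; case: (vQ n).
Qed.

(** The limit [w] of the values lies in the multivalued part, to which every value is orthogonal. By
    Pythagoras [|w| ^+ 2] is at most [|reg_op Q (u n) - w| ^+ 2], which tends to zero. *)
Lemma reg_op_closable (u : nat -> H) : (forall n, op_dom Q (u n)) ->
  u n @[n --> \oo] --> (0 : H) -> cauchy (reg_op Q (u n) @[n --> \oo]) ->
  reg_op Q (u n) @[n --> \oo] --> (0 : K).
Proof.
move=> Du u0 /cauchy_cvgP/cvg_ex[w uw].
have Mw : closure (graph Q) (0, w).
  apply: (closed_cvg (closure (graph Q))
    (u_ := fun n => (u n, reg_op Q (u n))) (F := \oo)).
  - exact: closed_closure.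
  - by apply: nearW => n; apply: reg_op_closure.
  - exact: cvg_pair.
suff /eqP : `|w| ^+ 2 = 0.
  by rewrite sqrf_eq0 normr_eq0 => /eqP w0; rewrite -[X in _ --> X]w0.
apply/le_anti; rewrite exprn_ge0// andbT.
apply: (@cvg_le _ _ \oo _ (fun=> `|w| ^+ 2)
  (fun n => `|reg_op Q (u n) - w| ^+ 2)).
- exact: cvg_cst.
- rewrite [X in _ --> X](_ : _ = `|w - w| ^+ 2); last first.
    by rewrite subrr normr0 expr0n.
  by apply: cvg_sqr_norm; apply: cvgB => //; apply: cvg_cst.
- by move=> n; rewrite pythagorasB ?reg_op_orth// lerDr exprn_ge0.
Qed.

End RegularPart.

(** * Nonnegative forms and shifts of semibounded forms *)

Section Forms.
Context {R : realType} {H : hilbertType R}.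
Implicit Types t u : pform H.

(** Dividing [0 <= s (e *: x + y) (e *: x + y)] by [e] bounds the negated cross terms by
    [e * s x x + e^-1 * s y y]. *)
Lemma form_young s (x y : H) (e : R[i]) : sesquilinear_form s ->
  (forall z, pf_dom s z -> 0 <= s z z) -> pf_dom s x -> pf_dom s y -> 0 < e ->
  s (y - x) (y - x) <= (1 + e) * s x x + (1 + e^-1) * s y y.
Proof.
move=> [/submod_closedP[_ DL] sl sr] s0 Dx Dy e0.
have Dz a : pf_dom s (a *: x + y) by exact: DL.
have sE a : s (a *: x + y) (a *: x + y) =
    a * (Num.conj a * s x x + s x y) + (Num.conj a * s y x + s y y).
  by rewrite sl// !sr.
have -> : s (y - x) (y - x) = s x x + s y y - (s x y + s y x).
  by rewrite addrC -scaleN1r sE rmorphN rmorph1; ring.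
have := s0 _ (Dz e); rewrite sE (conj_Creal (gtr0_real e0)).
rewrite -(pmulr_rge0 _ (_ : 0 < e^-1)) ?invr_gt0// => h.
rewrite -subr_ge0; apply: le_trans h _; rewrite le_eqVlt; apply/orP; left.
by apply/eqP; field; rewrite gt_eqF.
Qed.

Lemma bounded_below_shift u (d : R) : sesquilinear_form u ->
  bounded_below u d ->
  let s := PForm (pf_dom u) (fun x y => u x y - d%:C * inner x y) in
  sesquilinear_form s /\ forall x, pf_dom s x -> 0 <= s x x.
Proof.
move=> [D ul ur] ud; split=> [|x Dx /=]; last by rewrite inner_norm subr_ge0 ud.
split=> //= a x y z Dx Dy Dz; [rewrite ul// innerPl|rewrite ur// innerPr]; ring.
Qed.

End Forms.

(** * The regular part of a form: order, semiboundedness, closability *)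

Section RegularForm.
Context {R : realType} {H K : hilbertType R}.
Variables (t : pform H) (c : R) (Q : operator H K).
Hypothesis tQ : representing_map t c Q.

Let tr := reg_form t c Q.

Lemma representing_map_diag x :
  pf_dom t x -> t x x = c%:C * `|x| ^+ 2 + `|Q x| ^+ 2.
Proof. by case: tQ => _ _ tE Dx; rewrite tE// !inner_norm. Qed.

Lemma reg_form_diag x : tr x x = c%:C * `|x| ^+ 2 + `|reg_op Q x| ^+ 2.
Proof. by rewrite /= !inner_norm. Qed.

Lemma reg_form_le : le_form tr t.
Proof.
case: tQ => Qlin _ _; split=> // x Dx.
by rewrite reg_form_diag representing_map_diag// lerD2l reg_op_norm_le.
Qed.

Lemma reg_form_semibounded : semibounded_form t -> semibounded_form tr.
Proof.
case: tQ => Qlin QD _ [[D _ _] nz _]; split=> //; last first.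
  by exists c => x _; rewrite reg_form_diag lerDl exprn_ge0.
have regL a x y : pf_dom t x -> pf_dom t y ->
    reg_op Q (a *: x + y) = a *: reg_op Q x + reg_op Q y.
  by rewrite -QD; exact: reg_op_linear.
split=> // a x y z Dx Dy Dz; rewrite /tr /reg_form; cbn [pf_val].
  by rewrite regL// !innerPl; ring.
by rewrite regL// !innerPr; ring.
Qed.

Lemma reg_form_closable : closable tr.
Proof.
case: tQ => Qlin QD _ x Dx x0 trx.
have Dx' n : op_dom Q (x n) by rewrite QD; exact: Dx.
have regx : reg_op Q (x n) @[n --> \oo] --> (0 : K).
  apply: reg_op_closable => //; apply/cauchy_subP/sqr_norm_cvg0.
  have xx : cauchy (x @ \oo) by apply/cvg_cauchy/cvg_ex; exists 0.
  have xx0 : `|x p.1 - x p.2| ^+ 2 @[p --> (\oo, \oo)] --> (0 : R[i]^o).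
    by apply/cvg_sqr_norm0/cauchy_subP.
  (* Subtracting [c] times the squared norm from the regular form leaves exactly the squared norm of
     the difference of the [reg_op Q] values. *)
  apply: eq_cvgl (cvgMlD0 (- c%:C) xx0 trx) => -[n m].
  rewrite reg_form_diag mulNr addKr -[x n - _]addrC -scaleN1r.
  by rewrite reg_op_linear// scaleN1r addrC.
apply: eq_cvgl (cvgMlD0 c%:C (cvg_sqr_norm0 x0) (cvg_sqr_norm0 regx)) => n.
by rewrite reg_form_diag.
Qed.

End RegularForm.

(** * Maximality among closable forms *)

Section Maximality.
Context {R : realType} {H K : hilbertType R}.
Variables (t : pform H) (c : R) (Q : operator H K).
Hypothesis tQ : representing_map t c Q.

(** The passage to the limit goes through the nonnegative shift [s] of [u] by [d]: Young's
    inequality for [x = f n - g n] is used with [s (g n) (g n)] tending to zero, first letting [n]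
    grow and then [e] shrink. *)
Lemma closable_le_reg_form (u : pform H) :
  semibounded_form u -> closable u -> le_form u t -> le_form u (reg_form t c Q).
Proof.
move=> [usesq _ [d ud]] ucl [tu ut]; split=> // x Dx.
have [Qlin QD _] := tQ.
have [ssesq s0] := bounded_below_shift usesq ud.
set s := PForm _ _ in ssesq s0.
have [f [Df fx Qfx]] : exists f : nat -> H, [/\ forall n, pf_dom t (f n),
    f n @[n --> \oo] --> x & Q (f n) @[n --> \oo] --> (reg_op Q x : K)].
  by rewrite -QD; apply: reg_op_approx; rewrite ?QD.
have st z : pf_dom t z -> s z z <= (c%:C - d%:C) * `|z| ^+ 2 + `|Q z| ^+ 2.
  move=> Dz; rewrite /= inner_norm mulrBl addrAC lerD2r.
  by rewrite -(representing_map_diag tQ)// ut.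
have DtB y z : pf_dom t y -> pf_dom t z -> pf_dom t (y - z).
  by rewrite -QD; apply: submod_closedB; case: Qlin.
have QB y z : pf_dom t y -> pf_dom t z -> Q (y - z) = Q y - Q z.
  case: Qlin => _ QL; rewrite -QD => Dy Dz.
  by rewrite addrC -scaleN1r QL// scaleN1r addrC.
pose g n := f n - x.
have Dg n : pf_dom u (g n) by apply/tu/DtB.
have g0 : g n @[n --> \oo] --> (0 : H).
  by rewrite -(subrr x); apply: cvgB => //; exact: cvg_cst.
have gB n m : g n - g m = f n - f m by rewrite /g opprB addrA subrK.
have fC : cauchy (f @ \oo) by apply/cvg_cauchy/cvg_ex; exists x.
have QfC : cauchy ((Q \o f) @ \oo).
  by apply/cvg_cauchy/cvg_ex; exists (reg_op Q x).
have f0 : `|f p.1 - f p.2| ^+ 2 @[p --> (\oo, \oo)] --> (0 : R[i]^o).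
  by apply/cvg_sqr_norm0/cauchy_subP.
have Qf0 : `|Q (f p.1) - Q (f p.2)| ^+ 2 @[p --> (\oo, \oo)] --> (0 : R[i]^o).
  by apply/cvg_sqr_norm0; exact: (cauchy_subP (Q \o f)).1.
have sf0 : s (f p.1 - f p.2) (f p.1 - f p.2)
    @[p --> (\oo, \oo)] --> (0 : R[i]^o).
  apply: squeeze_cvg0 (cvgMlD0 (c%:C - d%:C) f0 Qf0) _ => -[n m].
  rewrite s0 /=; last exact/tu/DtB.
  by rewrite -QB//; exact/st/DtB.
have ug0 : u (g p.1 - g p.2) (g p.1 - g p.2)
    @[p --> (\oo, \oo)] --> (0 : R[i]^o).
  apply: eq_cvgl (cvgMlD0 d%:C f0 sf0) => -[n m].
  by rewrite gB /= inner_norm addrC subrK.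
(* Closability of [u] enters here, along the null sequence [g]. *)
have sg0 : s (g n) (g n) @[n --> \oo] --> (0 : R[i]^o).
  apply: eq_cvgl (cvgMlD0 (- d%:C) (cvg_sqr_norm0 g0) (ucl g Dg g0 ug0)) => n.
  by rewrite /= inner_norm mulNr addrC.
pose L : R[i] := (c%:C - d%:C) * `|x| ^+ 2 + `|reg_op Q x| ^+ 2.
pose tf n := (c%:C - d%:C) * `|f n| ^+ 2 + `|Q (f n)| ^+ 2.
have tfL : tf n @[n --> \oo] --> (L : R[i]^o).
  exact: cvgMlD (cvg_sqr_norm fx) (cvg_sqr_norm Qfx).
have stf n : s (f n) (f n) <= tf n by exact: st.
have L0 : 0 <= L.
  by apply: (cvg_ge0 tfL) => n; apply: le_trans (stf n); apply/s0/tu.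
suff : s x x <= L.
  by rewrite reg_form_diag /L /= inner_norm mulrBl addrAC lerD2r.
apply: ler_mul1D_gt0 => // e e0.
have bound : (1 + e^-1) * s (g n) (g n) + (1 + e) * tf n @[n --> \oo] -->
    ((1 + e^-1) * 0 + (1 + e) * L : R[i]^o).
  exact: cvgMlD sg0 (cvgMl_tmp tfL).
have cst : (fun _ : nat => s x x) @ \oo --> (s x x : R[i]^o).
  exact: (@cvg_cst R[i]^o).
rewrite -[leRHS]add0r -(mulr0 (1 + e^-1)).
apply: cvg_le cst bound _ => n.
have fg : f n - g n = x by rewrite /g subKr.
have e'0 : 0 < e^-1 by rewrite invr_gt0.
(* The weight [e^-1] puts the large factor on the vanishing term [s (g n) (g n)] and leaves [1 + e]
   on [s (f n) (f n)]. *)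
have := form_young ssesq s0 (Dg n) (tu _ (Df n)) e'0.
rewrite fg invrK => /le_trans; apply.
by rewrite lerD2l ler_wpM2l// addr_ge0// ltW.
Qed.

End Maximality.

Theorem theorem3p2 (R : realType) (H : hilbertType R)
    (t : pform H) (ht : semibounded_form t)
    (K : hilbertType R) (c : R) (Q : operator H K)
    (hc : c <= lower_bound t) (hQ : representing_map t c Q) :
  [/\ le_form (reg_form t c Q) t,
      forall u : pform H, semibounded_form u -> le_form u t ->
        forall (K' : hilbertType R) (c' : R) (Q' : operator H K'),
          c' <= lower_bound u -> representing_map u c' Q' ->
          le_form (reg_form u c' Q') (reg_form t c Q),
      forall u : pform H, semibounded_form u -> closable u -> le_form u t ->
        le_form u (reg_form t c Q) &
      [/\ semibounded_form (reg_form t c Q),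
          closable (reg_form t c Q),
          le_form (reg_form t c Q) t &
          forall u : pform H,
            semibounded_form u -> closable u -> le_form u t ->
            le_form u (reg_form t c Q)]].
Proof.
split; [exact: reg_form_le| |exact: closable_le_reg_form|].
- move=> u su [tu ut] K' c' Q' _ uQ'; apply: closable_le_reg_form => //.
  + exact: reg_form_semibounded.
  + exact: reg_form_closable.
  + have [_ uru] := reg_form_le uQ'; split=> // x Dx.
    by apply: le_trans (ut _ Dx); exact/uru/tu.
- split; [exact: reg_form_semibounded|exact: reg_form_closable
         |exact: reg_form_le|exact: closable_le_reg_form].
Qed.
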